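(* Let $D=(V,E)$ be a digraph with $n=|V|$ vertices and $m=|E|$ arcs, let $\alpha\in[0,1)$, and let $Z=\sum_{v\in V}(d^+(v))^2$. Let $\rho(D)$ be the spectral radius of $A_\alpha(D)$. Then $$\rho(D)\le\frac{\alpha m}{n}+\sqrt{\frac{n-1}{n}\left(\alpha^2 Z+(1-\alpha)^2 m-\frac{(\alpha m)^2}{n}\right)}.$$ Equality holds if and only if one of the following holds: (i) $D\cong\overleftrightarrow{K_n}$; (ii) $D\cong\overleftrightarrow{K_k}\cup(n-k)K_1$ and $\alpha=1/k$ for some positive integer $k\le n$; (iii) $D$ is an empty digraph.
   Context: A digraph $D=(V,E)$ has a finite nonempty vertex set $V$ and an arc set $E\subseteq V\times V$ without self-loops (an arc $(u,v)\in E$ is written $u\to v$; both $u\to v$ and $v\to u$ may be present). $d^+(v)$ is the out-degree of $v$. The adjacency matrix $A(D)$ has $(u,v)$-entry $1$ if $u\to v$ is an arc and $0$ otherwise; $\mathrm{Deg}(D)$ is the diagonal matrix of out-degrees; $A_\alpha(D)=\alpha\,\mathrm{Deg}(D)+(1-\alpha)A(D)$. The spectral radius is the maximum modulus of the eigenvalues. $\overleftrightarrow{K_k}$ is the complete symmetric digraph on $k$ vertices (all arcs $u\to v$ with $u\ne v$); $\overleftrightarrow{K_k}\cup(n-k)K_1$ is its disjoint union with $n-k$ isolated vertices. An empty digraph is one with no arcs. *)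

(* Defs.v *)
From mathcomp Require Import all_boot all_order all_algebra.
From mathcomp Require Import reals complex.

Set Implicit Arguments.
Unset Strict Implicit.
Unset Printing Implicit Defensive.

Import Order.TTheory GRing.Theory Num.Theory.

Local Open Scope ring_scope.
Local Open Scope complex_scope.

Record digraph (V : finType) := Digraph {
  arcs : {set V * V};
  loopless : forall v, (v, v) \notin arcs
}.

Section Digraphs.

Variables (V : finType) (D : digraph V).

Definition arc (u v : V) : bool := (u, v) \in arcs D.

Definition outdeg (v : V) : nat := #|[set w | arc v w]|.

Definition is_empty : Prop := arcs D = set0.

(* Rows and columns are numbered by the enumeration of [V]. *)
Definition adj_mx (R : nzRingType) : 'M[R]_#|V| :=
  \matrix_(i, j) (arc (enum_val i) (enum_val j))%:R.

Definition deg_mx (R : nzRingType) : 'M[R]_#|V| :=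
  diag_mx (\row_i (outdeg (enum_val i))%:R).

Definition Aalpha (R : nzRingType) (alpha : R) : 'M[R]_#|V| :=
  alpha *: deg_mx R + (1 - alpha) *: adj_mx R.

End Digraphs.

Definition isomorphic (V W : finType) (D : digraph V) (D' : digraph W) : Prop :=
  exists2 f : V -> W, bijective f & forall u v, arc D' (f u) (f v) = arc D u v.

Fact complete_loopless (V : finType) (v : V) :
  (v, v) \notin [set p : V * V | p.1 != p.2].
Proof. by rewrite inE eqxx. Qed.

Definition complete (V : finType) : digraph V :=
  Digraph (@complete_loopless V).

Fact arcless_loopless (V : finType) (v : V) : (v, v) \notin @set0 (V * V)%type.
Proof. by rewrite inE. Qed.

Definition arcless (V : finType) : digraph V := Digraph (@arcless_loopless V).

Definition dunion_arcs (V W : finType) (D : digraph V) (D' : digraph W) :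
    {set (V + W) * (V + W)} :=
  [set p | match p with
           | (inl u, inl v) => arc D u v
           | (inr u, inr v) => arc D' u v
           | _ => false
           end].

Fact dunion_loopless (V W : finType) (D : digraph V) (D' : digraph W) x :
  (x, x) \notin dunion_arcs D D'.
Proof. by case: x => v; rewrite inE /arc loopless. Qed.

Definition dunion (V W : finType) (D : digraph V) (D' : digraph W) :
    digraph (V + W)%type :=
  Digraph (@dunion_loopless V W D D').

Section SpectralRadius.

Variables (R : realType) (n : nat) (A : 'M[R]_n).

Definition complex_mx : 'M[R[i]]_n := map_mx (real_complex R) A.

(* The complex eigenvalues, with multiplicity. *)
Definition eigenvalues : seq R[i] :=
  sval (closed_field_poly_normal (char_poly complex_mx)).

Definition spectral_radius : R :=
  \big[Num.max/0]_(z <- eigenvalues) ComplexField.Normc.normc z.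

Lemma mem_eigenvalues z : (z \in eigenvalues) = eigenvalue complex_mx z.
Proof.
rewrite eigenvalue_root_char /eigenvalues.
case: closed_field_poly_normal => s /= ->.
by rewrite (monicP (char_poly_monic _)) scale1r root_prod_XsubC.
Qed.

Lemma spectral_radius_ge z :
  eigenvalue complex_mx z -> ComplexField.Normc.normc z <= spectral_radius.
Proof. by rewrite -mem_eigenvalues => zA; apply: le_bigmax_seq. Qed.

Lemma spectral_radius_attained : (0 < n)%N ->
  exists2 z, eigenvalue complex_mx z
           & ComplexField.Normc.normc z = spectral_radius.
Proof.
move=> n_gt0.
have s_gt0 : (0 < size eigenvalues)%N.
  have := size_char_poly complex_mx; rewrite /eigenvalues.
  case: closed_field_poly_normal => s /= ->.
  rewrite (monicP (char_poly_monic _)) scale1r size_prod_XsubC => -[->] //.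
suff [z zA <-] : exists2 z, z \in eigenvalues
    & ComplexField.Normc.normc z = spectral_radius.
  by exists z => //; rewrite -mem_eigenvalues.
rewrite /spectral_radius; elim: eigenvalues s_gt0 => // x [|y s] IHs _.
  exists x; rewrite ?mem_head // big_cons big_nil max_l //.
  by case: x => a b; rewrite sqrtr_ge0.
have [z zs zE] := IHs isT; rewrite big_cons -zE.
case: leP => _; last by exists x; rewrite ?mem_head.
by exists z; rewrite // in_cons zs orbT.
Qed.

End SpectralRadius.

(* Main.v *)
(* If [x] is an eigenvector for an eigenvalue of maximal modulus [rho], then
   [y = |x|] satisfies [rho * |y|^2 <= y^T A y] because [A] is nonnegative.
   With [t] the trace of [A], the Cauchy-Schwarz inequality for the Frobenius
   inner product of [A - (t/n) I] and [y y^T / |y|^2 - I / n], whose squared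
   norm is [(n-1)/n], bounds [rho - t/n] and gives the inequality.  Equality
   forces [A = a I + c y y^T] with [c >= 0], so the arcs form a clique on the
   support [S] of [c y]; when some vertex lies outside [S] then [a = 0], and
   comparing the entries of [A] on [S] yields [alpha * #|S| = 1]. *)

Require Import Defs.
From mathcomp Require Import all_boot all_order all_algebra.
From mathcomp Require Import reals complex.
From mathcomp Require Import ring lra.

Import Order.TTheory GRing.Theory Num.Theory.
Local Open Scope ring_scope.

Local Notation arc := Defs.arc.

(** * Spectral radius and quadratic forms *)

Lemma normc_sum (R : realType) (I : finType) (F : I -> R[i]) :
  ComplexField.Normc.normc (\sum_i F i)
    <= \sum_i ComplexField.Normc.normc (F i).
Proof.
elim/big_ind2: _ => [|x1 y1 x2 y2 h1 h2|//].
  by rewrite ComplexField.Normc.normc0.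
by apply: le_trans (le_normcD _ _) _; apply: lerD.
Qed.

(* The moduli of an eigenvector serve as test vector: the triangle inequality
   replaces the Perron-Frobenius theorem. *)
Lemma spectral_radius_quadratic_form (R : realType) (n : nat) (A : 'M[R]_n) :
  (0 < n)%N -> (forall i j, 0 <= A i j) ->
  exists y : 'I_n -> R, [/\ forall i, 0 <= y i, 0 < \sum_i y i ^+ 2 &
    spectral_radius A * \sum_i y i ^+ 2 <= \sum_i \sum_j A i j * (y i * y j)].
Proof.
move=> n0 A0; have [z /eigenvalueP[x xA x0] <-] := spectral_radius_attained A n0.
have y0 i : 0 <= ComplexField.Normc.normc (x 0 i) by case: (x 0 i) => a b; rewrite sqrtr_ge0.
exists (fun i => ComplexField.Normc.normc (x 0 i)); split=> //.
  rewrite lt_neqAle sumr_ge0 ?andbT; last by move=> i _; rewrite sqr_ge0.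
  apply: contra x0; rewrite eq_sym psumr_eq0; last by move=> i _; rewrite sqr_ge0.
  move=> /allP h; apply/eqP/rowP => i; rewrite mxE.
  have /= := h i (mem_index_enum i); rewrite sqrf_eq0 => /eqP.
  exact: ComplexField.Normc.eq0_normc.
(* [x] is a row vector, a left eigenvector, so column [j] of [x A = z x] bounds [|z| |x_j|];
   multiplying by [|x_j|] and summing over [j] gives the form. *)
rewrite exchange_big mulr_sumr; apply: ler_sum => j _ /=.
move/rowP: xA => /(_ j); rewrite !mxE => xAj.
rewrite expr2 mulrA -ComplexField.Normc.normcM -xAj.
under eq_bigr do rewrite mulrA.
rewrite -mulr_suml ler_wpM2r //.
apply: le_trans (normc_sum _ _ _) _; apply: ler_sum => i _.
rewrite ComplexField.Normc.normcM mulrC !mxE /= expr0n /= addr0 sqrtr_sqr.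
by rewrite ger0_norm.
Qed.

Lemma sumr_delta (R : realType) (n : nat) (i : 'I_n) (F : 'I_n -> R) :
  \sum_j (i == j)%:R * F j = F i.
Proof.
rewrite (bigD1 i) //= eqxx mul1r big1 ?addr0 // => j.
by rewrite eq_sym => /negbTE ->; rewrite mul0r.
Qed.

(** * Rayleigh quotients, trace and Frobenius norm *)

Section TraceFrobenius.

Variables (R : realType) (n : nat) (A : 'M[R]_n) (y : 'I_n -> R).
Hypotheses (n_gt0 : (0 < n)%N) (y_gt0 : 0 < \sum_i y i ^+ 2).

Let s := \sum_i y i ^+ 2.
Let t := \tr A.
Let F := \sum_i \sum_j A i j ^+ 2.
Let N : R := n%:R.
Let q := \sum_i \sum_j A i j * (y i * y j).
Let b := (N - 1) / N.
Let G := F - t ^+ 2 / N.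
Let p := q / s - t / N.

Let N_gt0 : 0 < N. Proof. by rewrite ltr0n. Qed.
Let s_neq0 : s != 0. Proof. by rewrite gt_eqF. Qed.

(* [G] and [b] are the squared Frobenius norms of [A - (t/N) I] and
   [y y^T / s - I / N], and [p] is the inner product of these matrices. *)
Lemma frobenius_lagrange :
  \sum_i \sum_j (b * (A i j - t / N * (i == j)%:R)
     - p * (y i * y j / s - (i == j)%:R / N)) ^+ 2 = b * (b * G - p ^+ 2).
Proof.
pose d (i j : 'I_n) : R := (i == j)%:R.
have N0 : N != 0 by rewrite gt_eqF.
have dd i j : d i j ^+ 2 = d i j by rewrite /d; case: eqP => _; rewrite ?expr1n ?expr0n.
(* Each difference is [b * A i j + w * (y i * y j) + u * d i j]; since [d] is idempotent, every term
   of the square containing it collapses to the diagonal. *)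
pose u := - (b * t / N) + p / N; pose w := - (p / s).
have E i j : (b * (A i j - t / N * (i == j)%:R)
     - p * (y i * y j / s - (i == j)%:R / N)) ^+ 2 =
   b ^+ 2 * A i j ^+ 2 + w ^+ 2 * (y i ^+ 2 * y j ^+ 2) +
   2 * b * w * (A i j * (y i * y j))
   + d i j * (u ^+ 2 + 2 * b * u * A i j + 2 * u * w * (y i * y j)).
  rewrite -/(d i j) /u /w; have := dd i j; set D := d i j => hD.
  transitivity ((b * A i j + w * (y i * y j)) ^+ 2
     + D ^+ 2 * u ^+ 2 + 2 * (b * A i j + w * (y i * y j)) * D * u).
    by rewrite /u /w; field; rewrite N0 s_neq0.
  by rewrite hD /u /w; ring.
under eq_bigr => i _.
  under eq_bigr do rewrite E.
  rewrite !big_split /= sumr_delta -!mulr_sumr.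
  over.
rewrite !big_split /= -!mulr_sumr -mulr_suml sumr_const card_ord -[_ *+ n]mulr_natl.
rewrite -/s -/N -/q -/F -/(\tr A) -/t.
by rewrite /u /w /G /p /b; field; rewrite N0 s_neq0.
Qed.

Let b_ge0 : 0 <= b.
Proof. by rewrite /b divr_ge0 ?(ltW N_gt0) // subr_ge0 ler1n. Qed.

(** Lagrange's identity equates [b * (b * G - p ^+ 2)] with a sum of squares, and [b > 0] from
    dimension 2 on. *)
Lemma frobenius_cauchy_schwarz : (1 < n)%N -> p ^+ 2 <= b * G.
Proof.
move=> n1.
have b0 : 0 < b by rewrite /b divr_gt0 // subr_gt0 ltr1n.
have : 0 <= b * (b * G - p ^+ 2).
  rewrite -frobenius_lagrange sumr_ge0 // => i _.
  by rewrite sumr_ge0 // => j _; rewrite sqr_ge0.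
by rewrite pmulr_rge0 // subr_ge0.
Qed.

Lemma scalar_of_dim1 : n = 1%N -> b = 0 /\ forall i j, A i j = t * (i == j)%:R.
Proof.
move=> n1; split; first by rewrite /b /N n1 subrr mul0r.
have eq_ord (i j : 'I_n) : i = j.
  by apply/val_inj; case: i j => [[|i] ltin] [[|j] ltjn] //; move: ltin ltjn; rewrite n1.
move=> i j; rewrite (eq_ord j i) eqxx mulr1 /t /mxtrace (bigD1 i) //= big1 ?addr0 //.
by move=> k; rewrite (eq_ord k i) eqxx.
Qed.

(* In dimension 1 Lagrange's identity says nothing, since [b = 0]; but then
   [p] vanishes as well. *)
Lemma rayleigh_le_trace_frobenius r :
  r * s <= q -> r <= t / N + Num.sqrt (b * G).
Proof.
move=> rs; rewrite -lerBlDl; apply: (@le_trans _ _ p).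
  by rewrite /p lerB // ler_pdivlMr.
have [n1|] := ltnP 1 n.
  apply: le_trans (ler_norm _) _; rewrite -sqrtr_sqr ler_wsqrtr //.
  exact: frobenius_cauchy_schwarz.
rewrite leq_eqVlt ltnS leqNgt n_gt0 orbF => /eqP n1.
have [-> EA] := scalar_of_dim1 n1; rewrite mul0r sqrtr0.
suff qE : q = t * s by rewrite /p qE mulfK // /N n1 divr1 subrr.
rewrite /q mulr_sumr; apply: eq_bigr => i _.
under eq_bigr do rewrite EA -mulrA mulrCA.
by rewrite sumr_delta expr2.
Qed.

(** Equality in Cauchy-Schwarz makes every square in Lagrange's identity vanish, so the two matrices
    are proportional. *)
Lemma rayleigh_eq_trace_frobenius r :
  r * s <= q -> r = t / N + Num.sqrt (b * G) ->
  exists a c, 0 <= c /\ forall i j, A i j = a * (i == j)%:R + c * (y i * y j).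
Proof.
move=> rs rE; have [n1|] := ltnP 1 n; last first.
  rewrite leq_eqVlt ltnS leqNgt n_gt0 orbF => /eqP n1.
  have [_ EA] := scalar_of_dim1 n1.
  by exists t, 0; split=> // i j; rewrite mul0r addr0.
have b0 : 0 < b by rewrite /b divr_gt0 // subr_gt0 ltr1n.
have CS := frobenius_cauchy_schwarz n1.
(* [p] is squeezed: the assumed equality puts it above the square root, Cauchy-Schwarz below. *)
have le_p : Num.sqrt (b * G) <= p.
  suff -> : Num.sqrt (b * G) = r - t / N by rewrite /p lerB // ler_pdivlMr.
  by rewrite rE addrC addKr.
have p0 : 0 <= p by apply: le_trans le_p; rewrite sqrtr_ge0.
have pE : p ^+ 2 = b * G.
  apply/le_anti; rewrite CS /=.
  have bG0 : 0 <= b * G by apply: le_trans CS; rewrite sqr_ge0.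
  by rewrite -[leLHS]sqr_sqrtr // ler_sqr // nnegrE sqrtr_ge0.
have := frobenius_lagrange; rewrite pE subrr mulr0 => /eqP.
rewrite psumr_eq0 => [/allP h|i _]; last by rewrite sumr_ge0 // => j _; rewrite sqr_ge0.
have EA i j : b * (A i j - t / N * (i == j)%:R)
     - p * (y i * y j / s - (i == j)%:R / N) = 0.
  have /= := h i (mem_index_enum i); rewrite psumr_eq0 => [/allP hi|k _]; last exact: sqr_ge0.
  by have /= := hi j (mem_index_enum j); rewrite sqrf_eq0 => /eqP.
(* These coefficients come from solving the vanishing entries [EA] for [A i j]. *)
exists (t / N - p / b / N), (p / b / s); split.
  exact: divr_ge0 (divr_ge0 p0 b_ge0) (ltW y_gt0).
move=> i j; apply: (mulfI (lt0r_neq0 b0)); move/eqP: (EA i j); rewrite subr_eq0 => /eqP.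
have N0 : N != 0 by rewrite gt_eqF.
have bn0 := lt0r_neq0 b0.
have -> : b * ((t / N - p / b / N) * (i == j)%:R + p / b / s * (y i * y j))
  = b * (t / N * (i == j)%:R) + p * (y i * y j / s - (i == j)%:R / N).
  move: (b) bn0 (p) => b' bn0 p'; field; by rewrite N0 s_neq0 bn0.
by move=> <-; rewrite mulrBr addrC subrK.
Qed.

End TraceFrobenius.

(** * Trace and Frobenius norm of the digraph matrix *)

Lemma sum_enum_val (R : nmodType) (V : finType) (F : V -> R) :
  \sum_(i < #|V|) F (enum_val i) = \sum_v F v.
Proof. by rewrite [RHS](reindex _ (onW_bij _ (@enum_val_bij V))). Qed.

Section DigraphSums.

Variables (R : realType) (V : finType) (D : digraph V) (alpha : R).

Lemma arc_irrefl v : arc D v v = false.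
Proof. exact/negbTE/loopless. Qed.

Lemma AalphaE i j : Aalpha D alpha i j =
  alpha * (outdeg D (enum_val i))%:R * (i == j)%:R
  + (1 - alpha) * (arc D (enum_val i) (enum_val j))%:R.
Proof. by rewrite !mxE -mulrA mulr_natr. Qed.

Lemma sum_arc v : \sum_w (arc D v w)%:R = (outdeg D v)%:R :> R.
Proof.
by rewrite -natr_sum /outdeg cardsE -sum1_card [in RHS]big_mkcond; congr _%:R.
Qed.

Lemma sum_outdeg : \sum_v (outdeg D v)%:R = #|arcs D|%:R :> R.
Proof.
under eq_bigr do rewrite -sum_arc.
rewrite pair_big /= -natr_sum -sum1_card [in RHS]big_mkcond; congr _%:R.
by apply: eq_bigr => -[u w] _; rewrite /arc /=; case: (_ \in _).
Qed.

Lemma trace_Aalpha : \tr (Aalpha D alpha) = alpha * #|arcs D|%:R.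
Proof.
rewrite -sum_outdeg mulr_sumr -[RHS]sum_enum_val; apply: eq_bigr => i _.
by rewrite AalphaE eqxx arc_irrefl mulr1 mulr0 addr0.
Qed.

Lemma frobenius_Aalpha : \sum_i \sum_j Aalpha D alpha i j ^+ 2 =
  alpha ^+ 2 * (\sum_v (outdeg D v)%:R ^+ 2)
  + (1 - alpha) ^+ 2 * #|arcs D|%:R.
Proof.
rewrite -sum_outdeg !mulr_sumr -big_split -[RHS]sum_enum_val.
apply: eq_bigr => i _ /=.
(* No cross term survives, as there are no loops; a 0/1 entry is its own square. *)
have E j : Aalpha D alpha i j ^+ 2 =
   (i == j)%:R * (alpha * (outdeg D (enum_val i))%:R) ^+ 2
   + (1 - alpha) ^+ 2 * (arc D (enum_val i) (enum_val j))%:R.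
  rewrite AalphaE; case: eqP => [<-|_].
    by rewrite arc_irrefl /=; ring.
  by case: (arc _ _ _) => /=; ring.
under eq_bigr do rewrite E.
rewrite big_split /= sumr_delta exprMn -mulr_sumr; congr (_ + _ * _).
by rewrite (sum_enum_val _ _ (fun w => (arc D (enum_val i) w)%:R)) sum_arc.
Qed.

End DigraphSums.

(** * Cliques with isolated vertices *)

(** Stated inside [V], this covers both the complete digraph and its union with isolated vertices
    without a change of vertex type. *)
Definition clique_on {V : finType} (D : digraph V) (S : {set V}) :=
  forall u v, arc D u v = [&& u != v, u \in S & v \in S].

Lemma clique_on_setT (V : finType) (D : digraph V) :
  clique_on D setT <-> isomorphic D (complete 'I_#|V|).
Proof.
have completeE (W : finType) (u v : W) : arc (complete W) u v = (u != v).
  by rewrite /arc inE.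
split=> [h|[f bij_f h] u v].
  exists enum_rank; first exact: enum_rank_bij.
  by move=> u v; rewrite completeE h !inE !andbT (inj_eq enum_rank_inj).
by rewrite -h completeE !inE !andbT (inj_eq (bij_inj bij_f)).
Qed.

Lemma arc_dunion_complete_arcless (k l : nat) (x y : 'I_k + 'I_l) :
  arc (dunion (complete 'I_k) (arcless 'I_l)) x y = [&& x != y, is_inl x & is_inl y].
Proof.
rewrite /arc inE; case: x y => [x|x] [y|y]; rewrite ?andbF ?andbT //.
  by rewrite /arc inE.
by rewrite /arc inE.
Qed.

Lemma clique_on_isomorphic (V : finType) (D : digraph V) (k : nat) :
  (k <= #|V|)%N ->
  (exists2 S : {set V}, #|S| = k & clique_on D S) <->
  isomorphic D (dunion (complete 'I_k) (arcless 'I_(#|V| - k))).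
Proof.
move=> lekV; split=> [[S cardS hS]|[f bij_f h]].
  have cardSC : (#|V| - k)%N = #|~: S| by rewrite -(cardsC S) cardS addKn.
  pose g (x : 'I_k + 'I_(#|V| - k)) : V := match x with
    | inl i => enum_val (cast_ord (esym cardS) i)
    | inr i => enum_val (cast_ord cardSC i) end.
  have gS x : (g x \in S) = is_inl x.
    case: x => i /=; first exact: enum_valP.
    by apply/negbTE; have := enum_valP (cast_ord cardSC i); rewrite inE.
  (* Membership in [S] reveals the summand, so only collisions within one summand remain. *)
  have inj_g : injective g.
    move=> x y xy; have := gS x; rewrite xy gS.
    case: x y xy => [x|x] [y|y] //= /enum_val_inj/cast_ord_inj -> //.
  have [f gK fK] : bijective g.
    by apply: inj_card_bij inj_g _; rewrite card_sum !card_ord subnKC.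
  exists f; first by exists g.
  move=> u v; rewrite arc_dunion_complete_arcless (can_eq fK) hS.
  by rewrite -!gS !fK.
exists (f @^-1: [set x | is_inl x]).
  rewrite on_card_preimset; last exact: onW_bij.
  have -> : [set x | is_inl x] = (@inl 'I_k 'I_(#|V| - k)) @: setT.
    apply/setP => -[x|x]; rewrite !inE; first by rewrite imset_f.
    by apply/esym/imsetP => -[].
  by rewrite card_imset ?cardsT ?card_ord // => x y [].
by move=> u v; rewrite -h arc_dunion_complete_arcless !inE (inj_eq (bij_inj bij_f)).
Qed.

(** * Degree sums and spectral radius of a clique *)

Section Clique.

Variables (R : realType) (V : finType) (D : digraph V) (S : {set V}) (alpha : R).
Hypothesis D_clique : clique_on D S.

Let k : R := #|S|%:R.

Lemma outdeg_clique v : (outdeg D v)%:R = (v \in S)%:R * (k - 1) :> R.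
Proof.
rewrite -sum_arc; under eq_bigr do rewrite D_clique.
case vS: (v \in S); last by rewrite mul0r big1 // => w _; rewrite andbF.
rewrite mul1r /k (cardsD1 v S) vS natrD addrC addKr -sum1_card natr_sum [RHS]big_mkcond.
by apply: eq_bigr => w _; rewrite !inE eq_sym; case: (_ && _).
Qed.

Lemma sum_mem : \sum_v (v \in S)%:R = k :> R.
Proof.
rewrite /k -sum1_card natr_sum [RHS]big_mkcond.
by apply: eq_bigr => w _; case: (_ \in _).
Qed.

Lemma card_arcs_clique : #|arcs D|%:R = k * (k - 1) :> R.
Proof.
rewrite -sum_outdeg -sum_mem mulr_suml.
by apply: eq_bigr => v _; rewrite outdeg_clique sum_mem.
Qed.

Lemma sum_outdeg_sqr_clique :
  \sum_v (outdeg D v)%:R ^+ 2 = k * (k - 1) ^+ 2 :> R.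
Proof.
rewrite -[in RHS]sum_mem mulr_suml; apply: eq_bigr => v _.
by rewrite outdeg_clique sum_mem; case: (_ \in _) => /=; ring.
Qed.

(** The indicator of [S] is a left eigenvector: the column of a vertex of [S] sums over [S] to
    [alpha * (k - 1) + (1 - alpha) * (k - 1)]. *)
Lemma spectral_radius_clique_ge :
  (0 < #|S|)%N -> k - 1 <= spectral_radius (Aalpha D alpha).
Proof.
move=> S0.
have ev : eigenvalue (complex_mx (Aalpha D alpha)) (k - 1)%:C%C.
  rewrite /complex_mx eigenvalue_map; apply/eigenvalueP.
  exists (\row_i (enum_val i \in S)%:R); last first.
    have [v vS] := card_gt0P S0; apply/eqP => /rowP/(_ (enum_rank v)).
    by rewrite !mxE enum_rankK vS; apply/eqP/oner_neq0.
  apply/rowP => j; rewrite !mxE.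
  (* The last term counts [i = j] as if it were an arc; the [- (1 - alpha)] in the diagonal term
     compensates. *)
  have E i : (\row_i (enum_val i \in S)%:R) 0 i * Aalpha D alpha i j =
     (j == i)%:R * ((enum_val j \in S)%:R * (k - 1) * alpha
                     - (1 - alpha) * (enum_val j \in S)%:R)
      + (enum_val i \in S)%:R * (1 - alpha) * (enum_val j \in S)%:R.
    rewrite mxE AalphaE D_clique outdeg_clique (inj_eq enum_val_inj) eq_sym.
    by case: eqP => [->|_]; case: (enum_val _ \in S); rewrite /= ?andbF ?andbT;
      case: (enum_val i \in S) => /=; ring.
  under eq_bigr do rewrite E.
  rewrite big_split /= sumr_delta -!mulr_suml.
  rewrite (sum_enum_val _ _ (fun v => (v \in S)%:R)) sum_mem.
  by ring.
apply: le_trans (spectral_radius_ge ev).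
by rewrite /= expr0n /= addr0 sqrtr_sqr ler_norm.
Qed.

End Clique.

(** * From a scalar plus rank-one matrix to a clique *)

Lemma clique_on_of_rank_one (R : realType) (V : finType) (D : digraph V)
    (alpha a c : R) (y : 'I_#|V| -> R) :
  0 <= alpha < 1 -> 0 <= c -> (forall i, 0 <= y i) ->
  (forall i j, Aalpha D alpha i j = a * (i == j)%:R + c * (y i * y j)) ->
  is_empty D \/ exists S : {set V}, clique_on D S /\
    (S = setT \/ (0 < #|S|)%N /\ alpha = #|S|%:R^-1).
Proof.
move=> /andP[al0 al1] c0 y0 EA.
(* [S] is the support of [c * z] rather than of [z], so that it is empty when [c = 0]. *)
pose z v := y (enum_rank v); pose S := [set v | 0 < c * z v].
have off u v : u != v -> (1 - alpha) * (arc D u v)%:R = c * z u * z v.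
  move=> uv; have := EA (enum_rank u) (enum_rank v).
  by rewrite AalphaE !enum_rankK (inj_eq enum_rank_inj) (negbTE uv) !mulr0 !add0r mulrA.
have diag v : alpha * (outdeg D v)%:R = a + c * z v ^+ 2.
  have := EA (enum_rank v) (enum_rank v).
  by rewrite AalphaE !enum_rankK eqxx arc_irrefl !mulr1 mulr0 addr0 expr2.
have memS v : (v \in S) = (c != 0) && (z v != 0).
  by rewrite inE lt_neqAle mulr_ge0 ?y0 // andbT eq_sym mulf_eq0 negb_or.
have DS : clique_on D S.
  move=> u v; have [->|uv /=] := eqVneq u v; first by rewrite arc_irrefl.
  have := off _ _ uv; rewrite !memS.
  have al1' : 1 - alpha != 0 by rewrite subr_eq0 gt_eqF.
  case: (arc D u v) => /= [|/esym/eqP].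
    move=> E; have : c * z u * z v != 0 by rewrite -E mulr1.
    by rewrite !mulf_eq0 !negb_or => /andP[/andP[-> ->] ->].
  by rewrite mulr0 !mulf_eq0 -orbA => /or3P[] ->; rewrite ?andbF.
have [D0|[[u v] uv]] := set_0Vmem (arcs D); first by left.
right; exists S; split=> //.
have : arc D u v by [].
have := DS u v => -> /and3P[neq_uv uS vS].
have S0 : (0 < #|S|)%N by apply/card_gt0P; exists u.
have [->|ST] := eqVneq S setT; first by left.
right; split=> //.
(* A vertex [w] outside [S] has out-degree 0 and no rank-one contribution, so its diagonal entry is
   [a] and equals 0. *)
move: ST; rewrite -subTset => /subsetPn[w _]; rewrite inE -leNgt => zw.
have cz_w : c * z w = 0 by apply/le_anti; rewrite zw mulr_ge0 ?y0.
have a_eq0 : a = 0.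
  have := diag w; rewrite (outdeg_clique _ _ _ _ DS) inE cz_w ltxx mul0r mulr0.
  by rewrite expr2 mulrA cz_w mul0r addr0.
have diagS x : x \in S -> c * z x ^+ 2 = alpha * (#|S|%:R - 1).
  by move=> xS; rewrite -[LHS]add0r -a_eq0 -diag (outdeg_clique _ _ _ _ DS) xS mul1r.
have c_neq0 : c != 0.
  by move: uS; rewrite inE; apply: contraTneq => ->; rewrite mul0r ltxx.
(* With [z u = z v], the off-diagonal entry [1 - alpha] equals [c * z u ^+ 2], which is
   [alpha * (#|S| - 1)] on the diagonal. *)
have zuv : z u = z v.
  apply/eqP; rewrite -(@eqrXn2 _ 2) ?y0 //; apply/eqP/(mulfI c_neq0).
  by rewrite !diagS.
have := off _ _ neq_uv; rewrite DS neq_uv uS vS mulr1 -zuv -mulrA -expr2 diagS // => E.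
have k0 : #|S|%:R != 0 :> R by rewrite pnatr_eq0 -lt0n.
by apply: (mulIf k0); rewrite mulVf //; lra.
Qed.

(** * The bound and its equality cases *)

Theorem theorem3p2 (R : realType) (V : finType) (D : digraph V) (alpha : R)
    (V_gt0 : (0 < #|V|)%N) (alpha_range : 0 <= alpha < 1) :
  let n : R := #|V|%:R in
  let m : R := #|arcs D|%:R in
  let Z : R := \sum_(v : V) (outdeg D v)%:R ^+ 2 in
  let rho : R := spectral_radius (Aalpha D alpha) in
  let bound : R := alpha * m / n
    + Num.sqrt ((n - 1) / n * (alpha ^+ 2 * Z + (1 - alpha) ^+ 2 * m
                                - (alpha * m) ^+ 2 / n)) in
  rho <= bound /\
  (rho = bound <->
     [\/ isomorphic D (complete 'I_#|V|),
         exists k : nat,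
           [/\ (0 < k)%N, (k <= #|V|)%N,
               isomorphic D (dunion (complete 'I_k) (arcless 'I_(#|V| - k)))
             & alpha = k%:R^-1]
       | is_empty D]).
Proof.
move=> n m Z rho bound; have /andP[al0 al1] := alpha_range.
have A0 i j : 0 <= Aalpha D alpha i j.
  by rewrite AalphaE addr_ge0 // !mulr_ge0 ?ler0n // subr_ge0 ltW.
have [y [y0 s0 yA]] := spectral_radius_quadratic_form _ _ _ V_gt0 A0.
have le_bound : rho <= bound.
  have := rayleigh_le_trace_frobenius _ _ _ _ V_gt0 s0 _ yA.
  by rewrite trace_Aalpha frobenius_Aalpha.
have n0 : n != 0 by rewrite pnatr_eq0 -lt0n.
have n1 : 0 <= n - 1 by rewrite subr_ge0 ler1n.
(* Only [bound <= rho] is left, and [rho] is at least [#|S| - 1]; in both cases the radicand is a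
   perfect square and the bound evaluates to [#|S| - 1]. *)
have clique_eq (S : {set V}) : (0 < #|S|)%N -> clique_on D S ->
    S = setT \/ alpha = #|S|%:R^-1 -> rho = bound.
  move=> S0 hS hk; apply/le_anti; rewrite le_bound /=.
  apply: le_trans (spectral_radius_clique_ge R _ _ _ alpha hS S0).
  have k0 : #|S|%:R != 0 :> R by rewrite pnatr_eq0 -lt0n.
  have k1 : 0 <= #|S|%:R - 1 :> R by rewrite subr_ge0 ler1n.
  rewrite /bound /m /Z (card_arcs_clique R _ _ _ hS) (sum_outdeg_sqr_clique R _ _ _ hS).
  case: hk => [ST|alE].
    have kn : #|S|%:R = n by rewrite ST cardsT.
    rewrite kn; set X := _ / n * _.
    have -> : X = ((1 - alpha) * (n - 1)) ^+ 2 by rewrite /X; field.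
    rewrite sqrtr_sqr ger0_norm; last by rewrite mulr_ge0 // subr_ge0 ltW.
    by rewrite le_eqVlt; apply/orP; left; apply/eqP; field.
  rewrite alE; set X := (n - 1) / n * _.
  have -> : X = ((n - 1) / n * (#|S|%:R - 1)) ^+ 2.
    by rewrite /X; field; rewrite n0 k0.
  rewrite sqrtr_sqr ger0_norm; last by rewrite mulr_ge0 // divr_ge0 // ler0n.
  by rewrite le_eqVlt; apply/orP; left; apply/eqP; field; rewrite n0 k0.
split=> //; split=> [rhoE|].
  have [a [c [c0 EA]]] : exists a c, 0 <= c /\
      forall i j, Aalpha D alpha i j = a * (i == j)%:R + c * (y i * y j).
    apply: (rayleigh_eq_trace_frobenius _ _ _ _ V_gt0 s0 _ yA).
    by rewrite trace_Aalpha frobenius_Aalpha.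
  have [D0|[S [hS [ST|[S0 alE]]]]] :=
    clique_on_of_rank_one _ _ _ _ _ _ _ alpha_range c0 y0 EA.
  - by constructor 3.
  - by constructor 1; apply/clique_on_setT; rewrite -ST.
  - constructor 2; exists #|S|; split=> //; first exact: max_card.
    by apply/clique_on_isomorphic; [exact: max_card|exists S].
case=> [/clique_on_setT hT|[k [k0 kV /clique_on_isomorphic h alE]]|D0].
- by apply: (clique_eq setT) => //; [rewrite cardsT|left].
- have [S cardS hS] := h kV.
  by apply: (clique_eq S) => //; rewrite cardS //; right.
- apply/le_anti; rewrite le_bound /=.
  (* The maximum defining the spectral radius starts from 0, hence is nonnegative. *)
  suff -> : bound = 0 by rewrite /rho /spectral_radius; apply: bigmax_ge_id.
  have m0 : m = 0 by rewrite /m D0 cards0.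
  have Z0 : Z = 0.
    apply: big1 => v _; rewrite /outdeg.
    have -> : [set w | arc D v w] = set0.
      by apply/setP => w; rewrite !inE /arc D0 inE.
    by rewrite cards0 expr0n.
  by rewrite /bound m0 Z0 !mulr0 expr0n /= !mul0r !addr0 subr0 mulr0 sqrtr0 addr0.
Qed.
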